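(* For each of the following five choices of base $a$, sequence $(\beta_n)_{n\ge0}$ and sequence $(\widetilde\alpha_m)_{m\ge0}$, the pair $(\alpha_m)_{m\ge0},(\beta_n)_{n\ge0}$ with $\alpha_m=\dfrac{1-aq^{2m}}{1-a}\,\widetilde\alpha_m$ is a Bailey pair with respect to the base $a$. 1. $a=q$, $\beta_n=\dfrac{1}{(q;q)_{2n}}$; $\ \widetilde\alpha_m=-q^{\frac13(2m^2-m)}$ if $m\equiv 2$, $\ \widetilde\alpha_m=q^{\frac13(2m^2-m)}$ if $m\equiv0$, $\ \widetilde\alpha_m=0$ if $m\equiv1\pmod 3$. 2. $a=q^2$, $\beta_n=\dfrac{1}{(q^2;q)_{2n}}$; $\ \widetilde\alpha_m=0$ if $m\equiv 2$, $\ \widetilde\alpha_m=q^{\frac13(2m^2+m)}$ if $m\equiv0$, $\ \widetilde\alpha_m=-q^{\frac13(2m^2+m)}$ if $m\equiv1\pmod 3$. 3. $a=q$, $\beta_n=\dfrac{q^{n^2-n}}{(q;q)_{2n}}$; $\ \widetilde\alpha_m=-q^{\frac13(m^2-2m)}$ if $m\equiv 2$, $\ \widetilde\alpha_m=q^{\frac13(m^2-2m)}$ if $m\equiv0$, $\ \widetilde\alpha_m=0$ if $m\equiv1\pmod 3$. 4. $a=q^2$, $\beta_n=\dfrac{q^{n^2}}{(q^2;q)_{2n}}$; $\ \widetilde\alpha_m=0$ if $m\equiv 2$, $\ \widetilde\alpha_m=q^{\frac13(m^2-m)}$ if $m\equiv0$, $\ \widetilde\alpha_m=-q^{\frac13(m^2-m)}$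 if $m\equiv1\pmod 3$. 5. $a=q$, $\beta_n=\dfrac{(-1;q^3)_n}{(q;q)_{2n}(-1;q)_n}$; $\ \widetilde\alpha_m=-q^{\frac12(m^2-m)}$ if $m\equiv 2$, $\ \widetilde\alpha_m=q^{\frac12(m^2-m)}$ if $m\equiv0$, $\ \widetilde\alpha_m=0$ if $m\equiv1\pmod 3$.
   Context: $q$ is a formal variable. $(x;q)_n=\prod_{0\le t<n}(1-xq^t)$ and $(x)_n=(x;q)_n$. Two sequences $(\alpha_n)_{n\ge0}$, $(\beta_n)_{n\ge0}$ form a Bailey pair with respect to the base $a$ if for all $n\ge0$ $$\beta_n=\sum_{t=0}^{n}\frac{\alpha_t}{(q)_{n-t}\,(aq)_{n+t}}.$$ *)

(* Defs.v *)
From HB Require Import structures.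
From mathcomp Require Import all_boot all_order all_algebra.

Set Implicit Arguments.
Unset Strict Implicit.
Unset Printing Implicit Defensive.

Import GRing.Theory.
Local Open Scope ring_scope.

Definition qpoch (F : fieldType) (x q : F) (n : nat) : F :=
  \prod_(t < n) (1 - x * q ^+ t).

(* Over an arbitrary field a denominator could vanish, and then 0^-1 = 0; this
   does not happen when q is an indeterminate over rat and a is a positive
   power of q. *)
Definition bailey_pair (F : fieldType) (q a : F) (alpha beta : nat -> F) : Prop :=
  forall n : nat,
    beta n = \sum_(t < n.+1) alpha t / (qpoch q q (n - t) * qpoch (a * q) q (n + t)).

Definition alpha_of (F : fieldType) (q a : F) (alphat : nat -> F) (m : nat) : F :=
  (1 - a * q ^+ (2 * m)) / (1 - a) * alphat m.

Definition Qq : fieldType := {fraction {poly rat}}.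

Definition q : Qq := tofrac ('X : {poly rat}).

(* In the sequences below, %/ is natural-number division and the subtractions
   are truncated.  Where the sequence is nonzero, the division is exact and
   the subtractions are genuine. *)

Definition alphat1 (m : nat) : Qq :=
  if (m %% 3 == 2)%N then - q ^+ ((2 * m ^ 2 - m) %/ 3)
  else if (m %% 3 == 0)%N then q ^+ ((2 * m ^ 2 - m) %/ 3)
  else 0.

Definition alphat2 (m : nat) : Qq :=
  if (m %% 3 == 2)%N then 0
  else if (m %% 3 == 0)%N then q ^+ ((2 * m ^ 2 + m) %/ 3)
  else - q ^+ ((2 * m ^ 2 + m) %/ 3).

Definition alphat3 (m : nat) : Qq :=
  if (m %% 3 == 2)%N then - q ^+ ((m ^ 2 - 2 * m) %/ 3)
  else if (m %% 3 == 0)%N then q ^+ ((m ^ 2 - 2 * m) %/ 3)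
  else 0.

Definition alphat4 (m : nat) : Qq :=
  if (m %% 3 == 2)%N then 0
  else if (m %% 3 == 0)%N then q ^+ ((m ^ 2 - m) %/ 3)
  else - q ^+ ((m ^ 2 - m) %/ 3).

Definition alphat5 (m : nat) : Qq :=
  if (m %% 3 == 2)%N then - q ^+ ((m ^ 2 - m) %/ 2)
  else if (m %% 3 == 0)%N then q ^+ ((m ^ 2 - m) %/ 2)
  else 0.

(* Main.v *)
(** Let a = q^(s+1).  After clearing the factors that depend on n only, each
    Bailey relation says that
      S_n = sum_t c_t (1 - a q^(2t)) / ((q)_(n-t) (q)_(n+t+s+1))
    has a product form, that is, satisfies a first-order recurrence in n.
    The defect of this recurrence telescopes when the terms t = 3r, 3r+1, 3r+2
    are taken together: their contribution is the difference between r+1 and r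
    of a boundary term, which is c_(3r) g(q^(n-3r), q^r) times
    1/((q)_(n+1-3r) (q)_(n+3r+s+1)) for a polynomial g.  The boundary term
    vanishes at r = 0, where g does, and for large r, where 1/(q)_(n+1-3r) = 0.
    The five polynomials g were read off from explicit partial sums. *)
Require Import Defs.
From mathcomp Require Import all_boot all_order all_algebra.
From mathcomp Require Import ring zify.
Import GRing.Theory.
Local Open Scope ring_scope.

Set Implicit Arguments.
Unset Strict Implicit.
Unset Printing Implicit Defensive.

(** * q-Pochhammer symbols and their reciprocals *)

Lemma qpochS (F : fieldType) (x q : F) n :
  qpoch x q n.+1 = qpoch x q n * (1 - x * q ^+ n).
Proof. by rewrite /qpoch big_ord_recr. Qed.

Lemma qpoch0 (F : fieldType) (x q : F) : qpoch x q 0 = 1.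
Proof. by rewrite /qpoch big_ord0. Qed.

Lemma qpochD (F : fieldType) (x q : F) m n :
  qpoch x q (m + n) = qpoch x q m * qpoch (x * q ^+ m) q n.
Proof.
rewrite /qpoch big_split_ord /=; congr (_ * _).
by apply: eq_bigr => t _; rewrite exprD mulrA.
Qed.

Lemma qpoch_neq0 (F : fieldType) (q : F) :
  (forall n, 1 - q ^+ n.+1 != 0) -> forall n, qpoch q q n != 0.
Proof. by move=> qn n; apply/prodf_neq0 => t _; rewrite -exprS. Qed.

(* 1/(q)_k with the convention that it is 0 for k < 0; this is what makes the
   recurrence [qpoch_inv_pred] hold for all integers k. *)
Definition qpoch_inv (F : fieldType) (q : F) (k : int) : F :=
  if k is Posz m then (qpoch q q m)^-1 else 0.

Lemma qpoch_inv_pred (F : fieldType) (q : F) :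
  (forall n, 1 - q ^+ n.+1 != 0) ->
  forall k : int, qpoch_inv q (k - 1) = (1 - q ^ k) * qpoch_inv q k.
Proof.
move=> qn [[|m]|m].
(* At [k = 0] the factor [1 - q ^ 0] vanishes, matching the value 0 assigned at [k = -1]. *)
- by rewrite expr0z subrr mul0r.
- rewrite (_ : m.+1%:Z - 1 = m); last by lia.
  by rewrite /qpoch_inv qpochS -exprS invfM mulrCA divff ?mulr1 //; apply: qn.
- rewrite (_ : Negz m - 1 = Negz m.+1); last by lia.
  by rewrite mulr0.
Qed.

(** * Telescoping in blocks of three indices *)

Lemma sum_ord_widen0 (V : nmodType) (f : nat -> V) m p :
  (m <= p)%N -> (forall t, (m <= t)%N -> f t = 0) ->
  \sum_(t < p) f t = \sum_(t < m) f t.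
Proof.
move=> mp f0; rewrite -(subnKC mp) big_split_ord /= [X in _ + X]big1 ?addr0 //.
by move=> t _; apply: f0; apply: leq_addr.
Qed.

(* With [y = q ^ r] and [z = q ^ (n - 3 * (r + 1))], this is the telescoping
   relation of [telescoping_triple] divided by the common factor
   [qpoch_inv q (n + 1 - 3 * r) * qpoch_inv q (n + 3 * (r + 1) + s + 1)];
   [x] stands for [q ^ n] and [w] for [q ^ (n - 3 * r)]. *)
Definition certificate_identity (F : fieldType) (q : F) (s : nat)
    (c0 c1 c2 c3 : F) (k : F -> F) (g : F -> F -> F) (y z : F) :=
  let w := z * q ^+ 3 in let x := w * y ^+ 3 in
  let v := x * y ^+ 3 * q ^+ s in
  let rho := (1 - x ^+ 2 * q ^+ s.+1) * (1 - x ^+ 2 * q ^+ s.+2) in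
  let a1 := 1 - w * q in let a2 := a1 * (1 - w) in
  let a3 := a2 * (1 - z * q ^+ 2) in
  let b1 := 1 - v * q ^+ 4 in let b2 := b1 * (1 - v * q ^+ 3) in
  let b3 := b2 * (1 - v * q ^+ 2) in
  c0 * (1 - y ^+ 6 * q ^+ s.+1) * (rho * b2 - k x * (a1 * b3))
  + c1 * (1 - y ^+ 6 * q ^+ (s + 3)) * (rho * (a1 * b1) - k x * (a2 * b2))
  + c2 * (1 - y ^+ 6 * q ^+ (s + 5)) * (rho * a2 - k x * (a3 * b1))
  = c3 * g z (y * q) * a3 - c0 * g w y * b3.

(** The difference [n - t] is taken in [int], so that the kernel is 0 for [t > n] and sums over [t]
    can be prolonged freely. *)
Definition kernel (F : fieldType) (q : F) (s n t : nat) : F :=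
  (1 - q ^+ (2 * t + s.+1)) * qpoch_inv q (n%:Z - t%:Z)
    * qpoch_inv q (n + t + s.+1)%N.

Definition boundary (F : fieldType) (q : F) s (c : nat -> F) (g : F -> F -> F)
    (n r : nat) : F :=
  c (3 * r)%N * g (q ^ (n%:Z - (3 * r)%N%:Z)) (q ^+ r)
    * qpoch_inv q (n%:Z + 1 - (3 * r)%N%:Z) * qpoch_inv q (n + 3 * r + s.+1)%N.

(** This is (q)_(2n+s+2) / (q)_(2n+s), the change in the denominator of the expected closed form b_n
    / (q)_(2n+s). *)
Definition ratio (F : fieldType) (q : F) (s n : nat) : F :=
  (1 - q ^+ (2 * n + s.+1)) * (1 - q ^+ (2 * n + s.+2)).

Lemma telescoping_triple (F : fieldType) (q : F) s c k g n r :
  q != 0 -> (forall m, 1 - q ^+ m.+1 != 0) ->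
  (forall z, certificate_identity q s (c (3 * r)%N) (c (3 * r).+1)
     (c (3 * r).+2) (c (3 * r.+1)%N) k g (q ^+ r) z) ->
  let d t := c t * (ratio q s n * kernel q s n.+1 t
                    - k (q ^+ n) * kernel q s n t) in
  d (3 * r)%N + d (3 * r).+1 + d (3 * r).+2
  = boundary q s c g n r.+1 - boundary q s c g n r.
Proof.
move=> q0 qn cert d.
(* The exponent is negative for large [r], hence the integer powers. *)
pose z := q ^ (n%:Z - (3 * r.+1)%N%:Z).
have zE (i : nat) : q ^ (n%:Z - (3 * r.+1)%N%:Z + i%:Z) = z * q ^+ i.
  by rewrite expfzDr.
have u_pred := qpoch_inv_pred qn.
have uL (i : nat) (k1 k2 : int) : k1 = k2 - 1 ->
    k2 = n%:Z - (3 * r.+1)%N%:Z + i%:Z ->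
    qpoch_inv q k1 = (1 - z * q ^+ i) * qpoch_inv q k2.
  by move=> -> E; rewrite u_pred -zE -E.
pose v := q ^+ (n + 3 * r + s).
have uR (i k1 k2 : nat) : k2 = k1.+1 -> k2 = (n + 3 * r + s + i)%N ->
    qpoch_inv q k1 = (1 - v * q ^+ i) * qpoch_inv q k2.
  move=> E E'; rewrite (_ : (k1%:Z = k2%:Z - 1)); last by lia.
  by rewrite u_pred {1}E' -exprnP exprD.
(* [A] and [B] have the largest indices that occur on the left and on the right. Every other
   reciprocal is one of them times a product of factors [1 - z * q ^+ i] or [1 - v * q ^+ i]. *)
pose A := qpoch_inv q (n%:Z + 1 - (3 * r)%N%:Z).
pose B := qpoch_inv q (n + 3 * r + s + 4)%N.
have A1 k1 : k1 = n%:Z - (3 * r)%N%:Z ->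
    qpoch_inv q k1 = (1 - z * q ^+ 4) * A.
  by move=> ->; apply: uL; lia.
have A2 k1 : k1 = n%:Z - (3 * r)%N%:Z - 1 ->
    qpoch_inv q k1 = (1 - z * q ^+ 3) * ((1 - z * q ^+ 4) * A).
  by move=> ->; rewrite -(A1 _ erefl); apply: uL; lia.
have A3 k1 : k1 = n%:Z - (3 * r)%N%:Z - 2 ->
    qpoch_inv q k1 =
    (1 - z * q ^+ 2) * ((1 - z * q ^+ 3) * ((1 - z * q ^+ 4) * A)).
  by move=> ->; rewrite -(A2 _ erefl); apply: uL; lia.
have B1 k1 : k1 = (n + 3 * r + s + 3)%N ->
    qpoch_inv q k1 = (1 - v * q ^+ 4) * B.
  by move=> ->; apply: uR; lia.
have B2 k1 : k1 = (n + 3 * r + s + 2)%N ->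
    qpoch_inv q k1 = (1 - v * q ^+ 3) * ((1 - v * q ^+ 4) * B).
  by move=> ->; rewrite -(B1 _ erefl); apply: uR; lia.
have B3 k1 : k1 = (n + 3 * r + s + 1)%N ->
    qpoch_inv q k1 =
    (1 - v * q ^+ 2) * ((1 - v * q ^+ 3) * ((1 - v * q ^+ 4) * B)).
  by move=> ->; rewrite -(B2 _ erefl); apply: uR; lia.
have wE : q ^ (n%:Z - (3 * r)%N%:Z) = z * q ^+ 3.
  by rewrite -zE; congr (_ ^ _); lia.
have xE : q ^+ n = z * q ^+ 3 * (q ^+ r) ^+ 3.
  rewrite -wE -exprM [in RHS]exprnP -expfzDr // exprnP.
  by congr (_ ^ _); lia.
have vE : v = q ^+ n * (q ^+ r) ^+ 3 * q ^+ s.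
  by rewrite -exprM -!exprD; congr (_ ^+ _); lia.
have rE : ratio q s n = (1 - (q ^+ n) ^+ 2 * q ^+ s.+1)
                        * (1 - (q ^+ n) ^+ 2 * q ^+ s.+2).
  by rewrite -!exprM -!exprD /ratio ![(n * 2)%N]mulnC.
have yE i : q ^+ (2 * (3 * r + i) + s.+1) =
            (q ^+ r) ^+ 6 * q ^+ (s + (2 * i + 1)).
  by rewrite -exprM -!exprD; congr (_ ^+ _); lia.
have := (yE 0%N, yE 1%N, yE 2%N).
rewrite !(addn0, addn1, addn2) => -[[y0 y1] y2].
move: (cert z); rewrite /certificate_identity /= -xE => cz.
rewrite /d /boundary /kernel y0 y1 y2.
rewrite wE -/z -/A.
rewrite (_ : qpoch_inv q (n.+1%:Z - (3 * r)%N%:Z) = A); last first.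
  by congr qpoch_inv; lia.
rewrite (_ : qpoch_inv q (n + 3 * r.+1 + s.+1)%N = B); last first.
  by congr qpoch_inv; lia.
rewrite (_ : qpoch_inv q (n.+1 + (3 * r).+2 + s.+1)%N = B); last first.
  by congr qpoch_inv; lia.
rewrite (A1 (n%:Z - (3 * r)%N%:Z)) //.
rewrite (A1 (n.+1%:Z - (3 * r).+1%:Z)); last by lia.
rewrite (A2 (n%:Z - (3 * r).+1%:Z)); last by lia.
rewrite (A3 (n%:Z - (3 * r).+2%:Z)); last by lia.
rewrite (A3 (n%:Z + 1 - (3 * r.+1)%N%:Z)); last by lia.
rewrite (B1 (n + (3 * r).+2 + s.+1)%N); last by lia.
rewrite (B1 (n.+1 + (3 * r).+1 + s.+1)%N); last by lia.
rewrite (B2 (n.+1 + 3 * r + s.+1)%N); last by lia.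
rewrite (B2 (n + (3 * r).+1 + s.+1)%N); last by lia.
rewrite (B3 (n + 3 * r + s.+1)%N); last by lia.
rewrite (exprSr q r) rE vE.
move: cz; rewrite ![q ^+ s.+2]exprSr ![q ^+ s.+1]exprSr ![q ^+ (s + _)]exprD.
move: (q ^+ n) (q ^+ r) (q ^+ s) (A) (B) (z) => x y S A' B' z'.
(* Each side of the goal is [A' * B'] times the corresponding side of the certificate. *)
set E1 := (X in X = _ -> _); set E2 := (X in _ = X -> _) => cz.
transitivity (E1 * (A' * B')); last rewrite cz; rewrite /E1 /E2; ring.
Qed.

Lemma sum_kernel_rec (F : fieldType) (q : F) s c k g n :
  q != 0 -> (forall m, 1 - q ^+ m.+1 != 0) -> (forall w, g w 1 = 0) ->
  (forall r z, certificate_identity q s (c (3 * r)%N) (c (3 * r).+1)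
     (c (3 * r).+2) (c (3 * r.+1)%N) k g (q ^+ r) z) ->
  ratio q s n * \sum_(t < n.+2) c t * kernel q s n.+1 t
  = k (q ^+ n) * \sum_(t < n.+1) c t * kernel q s n t.
Proof.
move=> q0 qn g1 cert.
pose d t := c t * (ratio q s n * kernel q s n.+1 t
                   - k (q ^+ n) * kernel q s n t).
have telescope r : \sum_(t < 3 * r) d t = boundary q s c g n r.
  elim: r => [|r IHr].
    by rewrite muln0 big_ord0 /boundary expr0 g1 mulr0 !mul0r.
  rewrite (_ : (3 * r.+1)%N = (3 * r).+3); last by lia.
  rewrite 3!big_ord_recr /= IHr -!addrA [X in _ + X]addrA.
  by rewrite [X in _ + X](telescoping_triple n q0 qn (cert r)) addrC subrK.
have kernel0 m t : (m.+1 <= t)%N -> c t * kernel q s m t = 0.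
  move=> mt; rewrite /kernel.
  rewrite (_ : m%:Z - t%:Z = Negz (t - m).-1); last by lia.
  by rewrite /= mulr0 mul0r mulr0.
(* With [r = n + 2] the range [3 * r] covers both sums, and [n + 1 - 3 * r = -(2 * n + 5)] is
   negative, so the boundary term is 0. *)
have := telescope n.+2.
rewrite /boundary (_ : n%:Z + 1 - (3 * n.+2)%N%:Z = Negz (2 * n + 4)); last by lia.
rewrite /= mulr0 mul0r => /eqP.
rewrite (eq_bigr (fun t : 'I__ => ratio q s n * (c t * kernel q s n.+1 t)
   - k (q ^+ n) * (c t * kernel q s n t))); last by move=> t _; rewrite /d; ring.
rewrite sumrB -!mulr_sumr subr_eq0 => /eqP.
rewrite (sum_ord_widen0 (m := n.+2) (f := fun t => c t * kernel q s n.+1 t));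
  [|by lia|exact: kernel0].
by rewrite (sum_ord_widen0 (m := n.+1) (f := fun t => c t * kernel q s n t));
  [|by lia|exact: kernel0].
Qed.

(** * From the recurrence to the Bailey pair *)

Lemma bailey_pair_of_certificate (F : fieldType) (q a : F) s c b beta k g :
  a = q ^+ s.+1 -> q != 0 -> (forall m, 1 - q ^+ m.+1 != 0) ->
  c 0%N = 1 -> b 0%N = 1 -> (forall n, b n.+1 = k (q ^+ n) * b n) ->
  (forall n, beta n = b n / qpoch a q (2 * n)) ->
  (forall w, g w 1 = 0) ->
  (forall r z, certificate_identity q s (c (3 * r)%N) (c (3 * r).+1)
     (c (3 * r).+2) (c (3 * r.+1)%N) k g (q ^+ r) z) ->
  bailey_pair q a (alpha_of q a c) beta.
Proof.
move=> -> q0 qn c0 b0 bS betaE g1 cert.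
have qp0 := qpoch_neq0 qn.
(* Both sides satisfy the same first-order recurrence in [n]. Multiplied by (q)_s, this becomes the
   Bailey relation: (q)_s / (q)_(2n+s) is 1/(a)_(2n), and (q)_s = (q)_(s+1) / (1 - a) accounts for
   the base change in (aq)_(n+t) and the denominator [1 - a] of [alpha_of]. *)
have sumE n : \sum_(t < n.+1) c t * kernel q s n t = b n / qpoch q q (2 * n + s).
  elim: n => [|n IHn].
    rewrite big_ord1 /= c0 b0 /kernel subrr /= qpoch0 invr1 mulr1 !mul1r.
    by rewrite muln0 !add0n qpochS -exprS invfM mulrCA divff ?mulr1.
  have rn : ratio q s n != 0 by rewrite /ratio !addnS mulf_neq0.
  apply: (mulfI rn); rewrite (sum_kernel_rec _ q0 qn g1 cert) IHn bS.
  rewrite (_ : (2 * n.+1 + s = (2 * n + s).+2)%N); last by lia.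
  rewrite !qpochS -!exprS /ratio !addnS.
  by field; rewrite qp0 !qn.
move=> n; rewrite betaE.
have -> : qpoch (q ^+ s.+1) q (2 * n) = qpoch q q (2 * n + s) / qpoch q q s.
  by rewrite addnC qpochD -exprS mulrC mulKf.
rewrite invf_div mulrCA -sumE mulr_sumr; apply: eq_bigr => t _.
have -> : qpoch (q ^+ s.+1 * q) q (n + t) =
          qpoch q q (n + t + s.+1) / qpoch q q s.+1.
  rewrite [(n + t + s.+1)%N]addnC (qpochD _ _ s.+1) [q * _]mulrC.
  by rewrite mulrAC divff ?mul1r.
rewrite /kernel /alpha_of -exprD [(s.+1 + _)%N]addnC.
rewrite (_ : n%:Z - t%:Z = (n - t)%N%:Z); last first.
  by rewrite -subzn // -ltnS.
rewrite /= [qpoch q q s.+1]qpochS -exprS.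
by field; rewrite !qp0 qn.
Qed.

(** * Nonvanishing in the field of rational functions *)

Lemma tofrac_neq0_of_horner (p : {poly rat}) x :
  p.[x] != 0 -> (tofrac p : Qq) != 0.
Proof. by rewrite tofrac_eq0; apply: contraNneq => ->; rewrite horner0. Qed.

Lemma q_neq0 : q != 0.
Proof. by apply: (@tofrac_neq0_of_horner _ 1); rewrite hornerX. Qed.

Lemma one_sub_qX_neq0 n : 1 - q ^+ n.+1 != 0.
Proof.
have -> : 1 - q ^+ n.+1 = tofrac (1 - 'X^(n.+1) : {poly rat}).
  by rewrite rmorphB rmorph1 rmorphXn.
by apply: (@tofrac_neq0_of_horner _ 0); rewrite !hornerE expr0n subr0.
Qed.

Lemma one_add_qX_neq0 n : 1 + q ^+ n != 0.
Proof.
have -> : 1 + q ^+ n = tofrac (1 + 'X^n : {poly rat}).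
  by rewrite rmorphD rmorph1 rmorphXn.
(* At 1 the value is 2 for every [n]. *)
by apply: (@tofrac_neq0_of_horner _ 1); rewrite !hornerE expr1n.
Qed.

(** The new factors have quotient (1 + x^3) / (1 + x) = 1 - x + x^2 at x = q^n. *)
Lemma cubic_qpoch_ratioS (F : fieldType) (q : F) n :
  (forall m, 1 + q ^+ m != 0) ->
  qpoch (-1) (q ^+ 3) n.+1 / qpoch (-1) q n.+1 =
  (1 - q ^+ n + (q ^+ n) ^+ 2) * (qpoch (-1) (q ^+ 3) n / qpoch (-1) q n).
Proof.
move=> qm; rewrite !qpochS !mulN1r !opprK exprAC.
have qpm : qpoch (-1) q n != 0.
  by apply/prodf_neq0 => t _; rewrite mulN1r opprK.
by field; rewrite qm qpm.
Qed.

(** * The five sequences and their certificates *)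

Lemma modn3_mul r : ((3 * r) %% 3 = 0)%N.
Proof. lia. Qed.

Lemma modn3_mulS r : ((3 * r).+1 %% 3 = 1)%N.
Proof. lia. Qed.

Lemma modn3_mulSS r : ((3 * r).+2 %% 3 = 2)%N.
Proof. lia. Qed.

Definition modn3E := (modn3_mul, modn3_mulS, modn3_mulSS).

Lemma qX_shift r i j m n :
  n = (m + r * i + j)%N -> q ^+ n = q ^+ m * (q ^+ r) ^+ i * q ^+ j.
Proof. by move=> ->; rewrite !exprD exprM. Qed.

(** At 3r, 3r+2 and 3r+3 the exponents are 6r^2 - r, 6r^2 + 7r + 2 and 6r^2 + 11r + 5. Their
    differences are linear in r, so the quotients are monomials in [q ^+ r] and [q]. The other four
    sequences behave alike. *)
Lemma alphat1_triple r :
  [/\ alphat1 (3 * r).+1 = 0,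
      alphat1 (3 * r).+2 = - (alphat1 (3 * r) * (q ^+ r) ^+ 8 * q ^+ 2)
    & alphat1 (3 * r.+1) = alphat1 (3 * r) * (q ^+ r) ^+ 12 * q ^+ 5].
Proof.
(* This lets [nia] see that the truncated subtractions are genuine. *)
have rr : (r <= r * r)%N by nia.
rewrite /alphat1 !modn3E /=; split=> //.
  by congr (- _); apply: qX_shift; nia.
by apply: qX_shift; nia.
Qed.

Lemma bailey_pair_alphat1 :
  bailey_pair q q (alpha_of q q alphat1)
    (fun n => 1 / qpoch q q (2 * n)).
Proof.
apply: (@bailey_pair_of_certificate _ q _ 0 alphat1 (fun=> 1) _
  (fun=> 1)
  (fun w y => - w * q + w * y ^+ 8 * q + w ^+ 2 * y ^+ 6 * (q + q ^+ 2)
     - w ^+ 2 * y ^+ 8 * (q + q ^+ 2) + w ^+ 3 * q ^+ 2 * y ^+ 8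
     - w ^+ 3 * q ^+ 2 * y ^+ 12)).
- by rewrite expr1.
- exact: q_neq0.
- exact: one_sub_qX_neq0.
- by rewrite /alphat1 /= expr0.
- by [].
- by move=> n; rewrite mulr1.
- by [].
- move=> w; ring.
move=> r z; have [c1 c2 c3] := alphat1_triple r.
rewrite /certificate_identity c1 c2 c3.
(* Only a polynomial identity in independent variables remains, with [E] a common factor. *)
move: (q ^+ r) (alphat1 _) => y E; move: q => p; ring.
Qed.

Lemma alphat2_triple r :
  [/\ alphat2 (3 * r).+2 = 0,
      alphat2 (3 * r).+1 = - (alphat2 (3 * r) * (q ^+ r) ^+ 4 * q ^+ 1)
    & alphat2 (3 * r.+1) = alphat2 (3 * r) * (q ^+ r) ^+ 12 * q ^+ 7].
Proof.
have rr : (r <= r * r)%N by nia.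
rewrite /alphat2 !modn3E /=; split=> //.
  by congr (- _); apply: qX_shift; nia.
by apply: qX_shift; nia.
Qed.

Lemma bailey_pair_alphat2 :
  bailey_pair q (q ^+ 2) (alpha_of q (q ^+ 2) alphat2)
    (fun n => 1 / qpoch (q ^+ 2) q (2 * n)).
Proof.
apply: (@bailey_pair_of_certificate _ q _ 1 alphat2 (fun=> 1) _
  (fun=> 1)
  (fun w y => - w * q + w * y ^+ 4 * q - w ^+ 2 * y ^+ 4 * q ^+ 2
     + w ^+ 2 * y ^+ 6 * (q ^+ 2 + q ^+ 3) - w ^+ 2 * y ^+ 10 * q ^+ 3
     + w ^+ 3 * y ^+ 10 * q ^+ 4 - w ^+ 3 * y ^+ 12 * q ^+ 4)).
- by [].
- exact: q_neq0.
- exact: one_sub_qX_neq0.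
- by rewrite /alphat2 /= expr0.
- by [].
- by move=> n; rewrite mulr1.
- by [].
- move=> w; ring.
move=> r z; have [c1 c2 c3] := alphat2_triple r.
rewrite /certificate_identity c1 c2 c3.
move: (q ^+ r) (alphat2 _) => y E; move: q => p; ring.
Qed.

Lemma alphat3_triple r :
  [/\ alphat3 (3 * r).+1 = 0,
      alphat3 (3 * r).+2 = - (alphat3 (3 * r) * (q ^+ r) ^+ 4 * q ^+ 0)
    & alphat3 (3 * r.+1) = alphat3 (3 * r) * (q ^+ r) ^+ 6 * q ^+ 1].
Proof.
have rr : (r <= r * r)%N by nia.
rewrite /alphat3 !modn3E /=; split=> //.
  by congr (- _); apply: qX_shift; nia.
by apply: qX_shift; nia.
Qed.

Lemma bailey_pair_alphat3 :
  bailey_pair q q (alpha_of q q alphat3)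
    (fun n => q ^+ (n ^ 2 - n) / qpoch q q (2 * n)).
Proof.
apply: (@bailey_pair_of_certificate _ q _ 0 alphat3 (fun n => q ^+ (n ^ 2 - n)) _
  (fun x => x ^+ 2)
  (fun w y => - 1 + y ^+ 4 - w * y ^+ 4 * (1 + q) + w * y ^+ 6 * (1 + q)
     + w ^+ 2 * y ^+ 4 * q - w ^+ 2 * y ^+ 12 * q)).
- by rewrite expr1.
- exact: q_neq0.
- exact: one_sub_qX_neq0.
- by rewrite /alphat3 /= expr0.
- by rewrite expr0.
(* The exponent n^2 - n grows by 2n, whence [k x = x ^+ 2]. *)
- move=> n; rewrite -exprM -exprD; congr (_ ^+ _); nia.
- by [].
- move=> w; ring.
move=> r z; have [c1 c2 c3] := alphat3_triple r.
rewrite /certificate_identity c1 c2 c3.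
move: (q ^+ r) (alphat3 _) => y E; move: q => p; ring.
Qed.

Lemma alphat4_triple r :
  [/\ alphat4 (3 * r).+2 = 0,
      alphat4 (3 * r).+1 = - (alphat4 (3 * r) * (q ^+ r) ^+ 2 * q ^+ 0)
    & alphat4 (3 * r.+1) = alphat4 (3 * r) * (q ^+ r) ^+ 6 * q ^+ 2].
Proof.
have rr : (r <= r * r)%N by nia.
rewrite /alphat4 !modn3E /=; split=> //.
  by congr (- _); apply: qX_shift; nia.
by apply: qX_shift; nia.
Qed.

Lemma bailey_pair_alphat4 :
  bailey_pair q (q ^+ 2) (alpha_of q (q ^+ 2) alphat4)
    (fun n => q ^+ (n ^ 2) / qpoch (q ^+ 2) q (2 * n)).
Proof.
apply: (@bailey_pair_of_certificate _ q _ 1 alphat4 (fun n => q ^+ (n ^ 2)) _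
  (fun x => x ^+ 2 * q)
  (fun w y => - 1 + y ^+ 2 - w * y ^+ 2 * q + w * y ^+ 6 * (q + q ^+ 2)
     - w * y ^+ 8 * q ^+ 2 + w ^+ 2 * y ^+ 8 * q ^+ 3 - w ^+ 2 * y ^+ 12 * q ^+ 3)).
- by [].
- exact: q_neq0.
- exact: one_sub_qX_neq0.
- by rewrite /alphat4 /= expr0.
- by rewrite expr0.
(* The exponent n^2 grows by 2n + 1, whence the extra factor [q] in [k]. *)
- move=> n; rewrite -exprM -exprSr -exprD; congr (_ ^+ _); nia.
- by [].
- move=> w; ring.
move=> r z; have [c1 c2 c3] := alphat4_triple r.
rewrite /certificate_identity c1 c2 c3.
move: (q ^+ r) (alphat4 _) => y E; move: q => p; ring.
Qed.

(** Since m^2 - m is even, halving is exact and the exponent increments are 6r + 1 and 9r + 3. *)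
Lemma alphat5_triple r :
  [/\ alphat5 (3 * r).+1 = 0,
      alphat5 (3 * r).+2 = - (alphat5 (3 * r) * (q ^+ r) ^+ 6 * q ^+ 1)
    & alphat5 (3 * r.+1) = alphat5 (3 * r) * (q ^+ r) ^+ 9 * q ^+ 3].
Proof.
have rr : (r <= r * r)%N by nia.
rewrite /alphat5 !modn3E /=; split=> //.
  by congr (- _); apply: qX_shift; nia.
by apply: qX_shift; nia.
Qed.

Lemma bailey_pair_alphat5 :
  bailey_pair q q (alpha_of q q alphat5)
    (fun n => qpoch (-1) (q ^+ 3) n / (qpoch q q (2 * n) * qpoch (-1) q n)).
Proof.
apply: (@bailey_pair_of_certificate _ q _ 0 alphat5
  (fun n => qpoch (-1) (q ^+ 3) n / qpoch (-1) q n) _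
  (fun x => 1 - x + x ^+ 2)
  (fun w y => - w * q - w * y ^+ 3 + w * y ^+ 6 + w * y ^+ 9 * q + w ^+ 2 * y ^+ 3 * q
     + w ^+ 2 * y ^+ 6 * q ^+ 2 - w ^+ 2 * y ^+ 9 * q ^+ 2 - w ^+ 2 * y ^+ 12 * q)).
- by rewrite expr1.
- exact: q_neq0.
- exact: one_sub_qX_neq0.
- by rewrite /alphat5 /= expr0.
- by rewrite !qpoch0 divr1.
- by move=> n; apply: cubic_qpoch_ratioS; exact: one_add_qX_neq0.
- by move=> n; rewrite invfM mulrCA mulrC.
- move=> w; ring.
move=> r z; have [c1 c2 c3] := alphat5_triple r.
rewrite /certificate_identity c1 c2 c3.
move: (q ^+ r) (alphat5 _) => y E; move: q => p; ring.
Qed.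

Theorem mainTheorem4 :
  [/\ bailey_pair q q (alpha_of q q alphat1)
        (fun n => 1 / qpoch q q (2 * n)),
      bailey_pair q (q ^+ 2) (alpha_of q (q ^+ 2) alphat2)
        (fun n => 1 / qpoch (q ^+ 2) q (2 * n)),
      bailey_pair q q (alpha_of q q alphat3)
        (fun n => q ^+ (n ^ 2 - n) / qpoch q q (2 * n)),
      bailey_pair q (q ^+ 2) (alpha_of q (q ^+ 2) alphat4)
        (fun n => q ^+ (n ^ 2) / qpoch (q ^+ 2) q (2 * n))
    & bailey_pair q q (alpha_of q q alphat5)
        (fun n => qpoch (-1) (q ^+ 3) n / (qpoch q q (2 * n) * qpoch (-1) q n))].
Proof.
split; [exact: bailey_pair_alphat1 | exact: bailey_pair_alphat2
  | exact: bailey_pair_alphat3 | exact: bailey_pair_alphat4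
  | exact: bailey_pair_alphat5].
Qed.
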